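(* Let $G=(V,E)$ be an unweighted graph on $n$ vertices with no vertex of degree $1$, and for $s,t\in V$ let $\mathcal{A}_{s,t}\subseteq 2^V$ denote the set of minimum $s,t$-cuts in $G$. Given a $(1/6,2n)$-friendly cut sparsifier $H$ of $G$ (its partition of $V$ into super-vertices together with its edges, each recorded with its original endpoints in $G$) and the degrees $\deg_G(v)$ of all $v\in V$, one can recover, for each pair $s,t\in V$, at least one cut $S\in\mathcal{A}_{s,t}$ together with its value $\mathrm{cut}_G(S)$.
   Context: Graphs are undirected, unweighted and simple. For $S\subseteq V$, $\mathrm{cut}_G(S)$ is the number of edges with exactly one endpoint in $S$; a minimum $s,t$-cut is a set $S$ with $s\in S\subseteq V\setminus\{t\}$ minimizing $\mathrm{cut}_G(S)$. For a cut $S$ and $v\in V$, let $c_v(S)$ be the number of edges incident to $v$ with exactly one endpoint in $S$; the friendliness ratio of $v$ with respect to $S$ is $1-c_v(S)/\deg(v)$. The cut $S$ is $\alpha$-friendly if every $v\in V$ has friendliness ratio at least $\alpha$. A contraction of $G$ is obtained from a partition of $V$ into parts (super-vertices) by contracting each part into a single vertex, keeping parallel edges and discarding self-loops; its edges are the edges of $G$ whose endpoints lie in different parts. An $(\alpha,w)$-friendly cut sparsifier of $G$ is a contraction $H$ of $G$ such that every $\alpha$-friendly cut $S\subseteq V$ with $\mathrm{cut}_G(S)\le w$ satisfies $\mathrm{cut}_H(S)=\mathrm{cut}_G(S)$, i.e., no super-vertex has vertices on both sides of $S$ (contracted pairs are viewed as joined by infinite-capacity edges). *)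

(* Defs.v *)
From HB Require Import structures.
From mathcomp Require Import all_boot all_order all_algebra.

Set Implicit Arguments.
Unset Strict Implicit.
Unset Printing Implicit Defensive.

(* Simple undirected graphs: an edge is the two-element set of its endpoints. *)
Record graph (V : finType) := Graph {
  edges : {set {set V}};
  edge_card : forall e, e \in edges -> #|e| = 2
}.

Section Graphs.

Variable V : finType.
Implicit Types (G : graph V) (e S B : {set V}) (s t v : V).

Definition crosses S e : bool := #|e :&: S| == 1.

Definition cut G S : nat := #|[set e in edges G | crosses S e]|.

Definition deg G v : nat := #|[set e in edges G | v \in e]|.

Definition crossing_deg G S v : nat :=
  #|[set e in edges G | (v \in e) && crosses S e]|.

(* The ratio is computed in rat, where 0 / 0 = 0: isolated vertices, which    *)
(* have no crossing edge, get ratio 1.                                        *)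
Definition friendliness G S v : rat :=
  (1 - (crossing_deg G S v)%:R / (deg G v)%:R)%R.

Definition friendly G (alpha : rat) S : Prop :=
  forall v, (alpha <= friendliness G S v)%R.

Definition min_st_cut G s t S : Prop :=
  [/\ s \in S, t \notin S &
      forall S', s \in S' -> t \notin S' -> cut G S <= cut G S'].

(* A contraction as raw data, not mentioning the graph it comes from. Each    *)
(* edge is stored as its pair of original endpoints, so that parallel edges   *)
(* between two super-vertices remain distinct.                                *)
Record contraction := Contraction {
  supervertices : {set {set V}};
  contracted_edges : {set {set V}}
}.

Implicit Type H : contraction.

Definition contraction_of G H : Prop :=
  partition (supervertices H) [set: V] /\
  contracted_edges H =
    [set e in edges G | ~~ [exists B in supervertices H, e \subset B]].

Definition unsplit B S : bool := (B \subset S) || [disjoint B & S].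

(* None is the value infinity, taken when some super-vertex meets both sides  *)
(* of S (contracted pairs are joined by edges of infinite capacity).          *)
Definition contraction_cut H S : option nat :=
  if [forall B in supervertices H, unsplit B S]
  then Some #|[set e in contracted_edges H | crosses S e]|
  else None.

Definition friendly_cut_sparsifier G (alpha : rat) (w : nat) H : Prop :=
  contraction_of G H /\
  forall S, friendly G alpha S -> cut G S <= w ->
    contraction_cut H S = Some (cut G S).

Lemma contraction_cutE G H S : contraction_of G H ->
  contraction_cut H S = Some (cut G S) <->
  (forall B, B \in supervertices H -> unsplit B S).
Proof.
case=> _ eH; rewrite /contraction_cut; case: ifP => [/forall_inP un|nun].
  split=> // _; congr (Some _); apply: eq_card => e; rewrite eH !inE.
  case eE: (e \in edges G) => //=; case xe: (crosses S e); last by rewrite andbF.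
  rewrite andbT; apply/negP => /exists_inP[B BH sB].
  have c2 := edge_card eE; move: xe; rewrite /crosses.
  case/orP: (un B BH) => [sBS|dBS].
    by rewrite (setIidPl (subset_trans sB sBS)) c2.
  suff -> : e :&: S = set0 by rewrite cards0.
  by apply/eqP; rewrite setI_eq0; apply: disjointWl dBS.
by split=> // un; move/forall_inP: nun; case.
Qed.

End Graphs.

(* Main.v *)
(** Flipping a vertex other than [s] and [t] cannot improve a minimum
[s,t]-cut [S], so every such vertex has at most half of its edges crossing, and
only [s] and [t] can be unfriendly. Let [X] be the set of unfriendly terminals;
flipping them turns [S] into [symdiff S X]. Any other vertex gains at most one
crossing edge, which is harmless unless its degree is 2; such a vertex could be
moved across [S] at no cost, raising the crossing degree of an unfriendly
terminal, so it does not occur if [S] maximises the total crossing degree of its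
unfriendly terminals among all minimum [s,t]-cuts. Then [symdiff S X] is
1/6-friendly of value at most [2n], hence preserved by [H].

Conversely, the value of a cut that separates [s] from [t] and differs from a
preserved cut only at terminals [X] is determined by [H] and the degrees: an
edge inside a super-vertex crosses it iff it has an endpoint in [X] (never two,
since two flipped terminals lie in different super-vertices). Minimising this value over
all such cuts recovers a minimum [s,t]-cut. *)

Require Import Defs.
From mathcomp Require Import all_boot all_order all_algebra.
From mathcomp Require Import zify lra.

Set Implicit Arguments.
Unset Strict Implicit.
Unset Printing Implicit Defensive.

Import Order.TTheory GRing.Theory Num.Theory.

(** * Crossing degrees and cut values when vertices switch sides *)

Section CutCalculus.

Variable V : finType.
Implicit Types (A B S X e : {set V}) (s t u v x y : V) (G : graph V).

Definition symdiff A B : {set V} := [set v | (v \in A) (+) (v \in B)].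

Lemma in_symdiff A B v : (v \in symdiff A B) = (v \in A) (+) (v \in B).
Proof. by rewrite inE. Qed.

Lemma crosses_pair S x y : x != y ->
  crosses S [set x; y] = (x \in S) (+) (y \in S).
Proof.
move=> xy; rewrite /crosses setIUl cardsU.
have -> : [set x] :&: S :&: ([set y] :&: S) = set0.
  apply/setP=> z; rewrite !inE; case: eqP => //= ->.
  by rewrite (negbTE xy) andbF.
have one z : #|[set z] :&: S| = (z \in S).
  case zS: (z \in S); first by rewrite (setIidPl _) ?cards1 // sub1set.
  by apply/eqP; rewrite cards_eq0 setI_eq0 disjoints1 zS.
by rewrite cards0 subn0 !one; case: (x \in S); case: (y \in S).
Qed.

Lemma edge_pair G e : e \in edges G ->
  exists x y, x != y /\ e = [set x; y].
Proof. by move/edge_card/eqP/cards2P => [x [y [xy ->]]]; exists x, y. Qed.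

Lemma crosses_symdiff G S X e : e \in edges G ->
  crosses (symdiff S X) e = crosses S e (+) crosses X e.
Proof.
case/edge_pair=> [x [y [xy ->]]]; rewrite !crosses_pair // !in_symdiff.
by do 4!case: (_ \in _).
Qed.

Lemma crosses1 G v e : e \in edges G -> crosses [set v] e = (v \in e).
Proof.
case/edge_pair=> [x [y [xy ->]]]; rewrite crosses_pair // !inE.
rewrite !(eq_sym v); case: (eqVneq x v) => [<-|_] //=.
by rewrite eq_sym (negbTE xy).
Qed.

Definition adj G v u : bool := [set v; u] \in edges G.

Lemma adjC G v u : adj G v u = adj G u v.
Proof. by rewrite /adj setUC. Qed.

Lemma adj_neq G v u : adj G v u -> v != u.
Proof.
by move/edge_card; rewrite cards2; case: (v == u).
Qed.

(** In a simple graph an edge at [v] is determined by its other endpoint, so counting edges at [v]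
    becomes counting neighbours. *)
Lemma incident_card G (P : pred {set V}) v :
  #|[set e in edges G | (v \in e) && P e]| =
  #|[set u | adj G v u && P [set v; u]]|.
Proof.
rewrite -(@card_in_imset _ _ (fun u => [set v; u])); last first.
  move=> x y; rewrite !inE => /andP[vx _] /andP[vy _] /setP /(_ x).
  rewrite !inE eqxx orbT eq_sym (negbTE (adj_neq vx)) /=.
  by move/esym/eqP.
apply: eq_card => e; rewrite inE; apply/and3P/imsetP.
  case=> eE ve Pe; have [x [y [xy eq_e]]] := edge_pair eE.
  move: ve; rewrite eq_e !inE => /orP[] /eqP vE.
    by exists y; rewrite vE // inE /adj -eq_e eE.
  exists x; last by rewrite vE setUC.
  by rewrite vE inE /adj setUC -eq_e eE.
by case=> u; rewrite inE => /andP[vu Pu] ->; split; rewrite // !inE eqxx.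
Qed.

Lemma deg_adj G v : deg G v = #|[set u | adj G v u]|.
Proof.
transitivity #|[set e in edges G | (v \in e) && predT e]|.
  by apply: eq_card => e; rewrite !inE andbT.
by rewrite incident_card; apply: eq_card => u; rewrite !inE andbT.
Qed.

Lemma crossing_deg_adj G S v :
  crossing_deg G S v = #|[set u | adj G v u && ((v \in S) (+) (u \in S))]|.
Proof.
rewrite /crossing_deg (incident_card G (crosses S)).
apply: eq_card => u; rewrite !inE; case vu: (adj G v u) => //=.
by rewrite crosses_pair // (adj_neq vu).
Qed.

Lemma deg_split G S v :
  deg G v = crossing_deg G S v +
            #|[set u | adj G v u && ~~ ((v \in S) (+) (u \in S))]|.
Proof.
rewrite deg_adj crossing_deg_adj -cardsUI [X in _ + X](_ : _ = 0) ?addn0.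
  by apply: eq_card => u; rewrite !inE -andb_orr orbN andbT.
apply/eqP; rewrite cards_eq0; apply/eqP/setP => u; rewrite !inE.
by rewrite andbACA andbN andbF.
Qed.

Lemma crossing_deg_le G S v : crossing_deg G S v <= deg G v.
Proof. by rewrite (deg_split G S v) leq_addr. Qed.

Lemma deg_ltn G v : deg G v < #|V|.
Proof.
rewrite deg_adj -[X in _ < X]cardsT; apply: proper_card.
apply/properP; split; first exact: subsetT.
by exists v; rewrite // inE; apply/negP => /adj_neq; rewrite eqxx.
Qed.

Lemma cut_set1 G s : cut G [set s] = deg G s.
Proof.
rewrite /cut /deg; apply: eq_card => e; rewrite !inE.
by case eE: (e \in edges G) => //=; rewrite (crosses1 s eE).
Qed.

Lemma crossing_deg_symdiff1 G S v :
  crossing_deg G (symdiff S [set v]) v + crossing_deg G S v = deg G v.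
Proof.
rewrite (deg_split G S v) addnC; congr (_ + _); rewrite crossing_deg_adj.
apply: eq_card => u; rewrite !inE eqxx; case vu: (adj G v u) => //=.
rewrite eq_sym (negbTE (adj_neq vu)).
by case: (v \in S); case: (u \in S).
Qed.

Lemma cut_split G S v :
  cut G S = crossing_deg G S v +
            #|[set e in edges G | (v \notin e) && crosses S e]|.
Proof.
rewrite /cut /crossing_deg -cardsUI [X in _ + X](_ : _ = 0) ?addn0.
  by apply: eq_card => e; rewrite !inE -!andb_orr -andb_orl orbN.
apply/eqP; rewrite cards_eq0; apply/eqP/setP => e; rewrite !inE.
by case: (v \in e); rewrite /= !andbF.
Qed.

(** Only edges at [v] change status, and there crossing and non-crossing edges swap roles. The
    additive form avoids truncated subtraction. *)
Lemma cut_symdiff1 G S v :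
  cut G (symdiff S [set v]) + 2 * crossing_deg G S v = cut G S + deg G v.
Proof.
rewrite (cut_split G S v) (cut_split G (symdiff S [set v]) v).
have -> : [set e in edges G | (v \notin e) && crosses (symdiff S [set v]) e] =
          [set e in edges G | (v \notin e) && crosses S e].
  apply/setP=> e; rewrite !inE; case eE: (e \in edges G) => //=.
  rewrite (crosses_symdiff S [set v] eE) (crosses1 v eE).
  by case: (v \in e); rewrite //= addbF.
by have := crossing_deg_symdiff1 G S v; lia.
Qed.

(** A newly crossing edge has an endpoint in [X] and did not cross [S]; a union bound over [X]
    counts such edges. *)
Lemma cut_symdiff_le G S X :
  cut G (symdiff S X) <=
  cut G S + \sum_(x in X) (deg G x - crossing_deg G S x).
Proof.
pose N x := [set e in edges G | (x \in e) && ~~ crosses S e].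
have cN x : #|N x| = deg G x - crossing_deg G S x.
  suff -> : deg G x = crossing_deg G S x + #|N x| by rewrite addKn.
  rewrite /deg /crossing_deg -cardsUI [X in _ + X](_ : _ = 0) ?addn0.
    by apply: eq_card => e; rewrite !inE -!andb_orr orbN andbT.
  apply/eqP; rewrite cards_eq0; apply/eqP/setP => e; rewrite !inE.
  by case: (crosses S e); rewrite /= !andbF.
under eq_bigr do rewrite -cN.
apply: (@leq_trans #|[set e in edges G | crosses S e] :|: \bigcup_(x in X) N x|).
  apply/subset_leq_card/subsetP => e; rewrite !inE => /andP[eE].
  rewrite (crosses_symdiff S X eE) eE /=.
  case cS: (crosses S e) => //= cX; apply/bigcupP.
  move/eqP: cX => cX; have /card_gt0P[x] : 0 < #|e :&: X| by rewrite cX.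
  by rewrite inE => /andP[xe xX]; exists x; rewrite // !inE eE xe cS.
apply: (leq_trans (leq_card_setU _ _)); rewrite leq_add2l.
elim/big_rec2: _ => [|x n A _ le]; first by rewrite cards0.
by apply: (leq_trans (leq_card_setU _ _)); rewrite leq_add2l.
Qed.

End CutCalculus.

(** * Turning a minimum cut into a friendly one *)

Section FriendlyModification.

Variables (V : finType) (G : graph V).
Implicit Types (A B S X e : {set V}) (s t u v x y : V).

Lemma friendly_sixth S :
  (forall v, 6 * crossing_deg G S v <= 5 * deg G v) ->
  friendly G (1 / 6%:R)%R S.
Proof.
move=> le v; rewrite /friendliness.
have := le v; have := crossing_deg_le G S v.
move: (crossing_deg G S v) (deg G v) => c [|d] cd c6.
  by move: cd; rewrite leqn0 => /eqP->; rewrite mul0r subr0.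
suff : (c%:R / d.+1%:R <= 5%:R / 6%:R :> rat)%R.
  by move: (c%:R / d.+1%:R)%R => q; lra.
rewrite ler_pdivrMr ?ltr0n // mulrAC ler_pdivlMr ?ltr0n //.
by rewrite -!natrM ler_nat mulnC.
Qed.

Lemma crossing_deg_symdiff_out S X v : v \notin X ->
  crossing_deg G (symdiff S X) v <= crossing_deg G S v +
    #|[set u in X | adj G v u && ((v \in S) == (u \in S))]|.
Proof.
move=> vX; rewrite !crossing_deg_adj -cardsUI.
apply: leq_trans (leq_addr _ _); apply/subset_leq_card/subsetP => u.
rewrite !inE (negbTE vX).
by case: (adj G v u); case: (v \in S); case: (u \in S); case: (u \in X).
Qed.

(** An edge at [v] that crosses both before and after the flip leads to another flipped vertex. *)
Lemma crossing_deg_symdiff_in S X v : v \in X ->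
  crossing_deg G (symdiff S X) v + crossing_deg G S v <= deg G v + #|X :\ v|.
Proof.
move=> vX; rewrite (deg_split G S v) [X in _ <= X]addnAC -addnA addnC.
rewrite leq_add2l !crossing_deg_adj addnC -cardsUI.
apply: leq_trans (leq_addr _ _); apply/subset_leq_card/subsetP => u.
rewrite !inE vX; case vu: (adj G v u) => //=.
rewrite eq_sym (negbTE (adj_neq vu)).
by case: (v \in S); case: (u \in S); case: (u \in X).
Qed.

Lemma crossing_deg_symdiff1_other S v x : v != x ->
  (adj G x v -> (x \in S) = (v \in S)) ->
  crossing_deg G (symdiff S [set v]) x = crossing_deg G S x + adj G x v.
Proof.
move=> vx same; rewrite !crossing_deg_adj.
case xv: (adj G x v) same => same.
  set A := [set u | adj G x u && ((x \in S) (+) (u \in S))].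
  have -> : #|A| + true = #|v |: A|.
    by rewrite cardsU1 !inE xv same // addbb addnC.
  apply: eq_card => u; rewrite !inE [x == v]eq_sym (negbTE vx) addbF.
  case: eqVneq => [->|_]; last by rewrite addbF.
  by rewrite xv same //; case: (v \in S).
rewrite addn0; apply: eq_card => u; rewrite !inE [x == v]eq_sym (negbTE vx) addbF.
by case: eqVneq => [->|_]; rewrite ?xv ?addbF.
Qed.

Lemma crossing_deg_min_st_cut s t S v : min_st_cut G s t S ->
  v != s -> v != t -> 2 * crossing_deg G S v <= deg G v.
Proof.
case=> sS tS minS vs vt; have := cut_symdiff1 G S v.
have /minS : s \in symdiff S [set v].
  by rewrite !inE sS eq_sym (negbTE vs).
rewrite !inE (negbTE tS) eq_sym (negbTE vt) => /(_ isT); lia.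
Qed.

Definition unfriendly S v : bool := 5 * deg G v < 6 * crossing_deg G S v.

Definition unfriendly_terminals s t S : {set V} :=
  [set x in [set s; t] | unfriendly S x].

Definition potential s t S : nat :=
  \sum_(x in unfriendly_terminals s t S) crossing_deg G S x.

Lemma exists_min_st_cut_max_potential s t : s != t ->
  exists2 S, min_st_cut G s t S &
    forall S', min_st_cut G s t S' -> potential s t S' <= potential s t S.
Proof.
move=> st.
pose sep S := (s \in S) && (t \notin S).
have sep1 : sep [set s] by rewrite /sep !inE eqxx eq_sym.
case: (arg_minnP (cut G) sep1) => S0 sep0 min0.
pose P S := sep S && (cut G S <= cut G S0).
have P0 : P S0 by rewrite /P sep0 leqnn.
case: (arg_maxnP (potential s t) P0) => S1 /andP[/andP[sS1 tS1] le1] max1.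
exists S1.
  split=> // S' sS' tS'; apply: leq_trans le1 (min0 _ _).
  by rewrite /sep sS' tS'.
case/andP: sep0 => s0 t0 S' [sS' tS' minS']; apply: max1.
by rewrite /= /P /sep sS' tS' minS'.
Qed.

Section MaxPotential.

Variables (s t : V) (S : {set V}).
Hypotheses (no_deg1 : forall v, deg G v <> 1) (minS : min_st_cut G s t S).
Hypothesis maxS :
  forall S', min_st_cut G s t S' -> potential s t S' <= potential s t S.

Let X := unfriendly_terminals s t S.

Let sS : s \in S. Proof. by case: minS. Qed.
Let tS : t \notin S. Proof. by case: minS. Qed.

Let XP x : x \in X -> x = s \/ x = t.
Proof. by rewrite !inE => /andP[/orP[] /eqP ->]; [left|right]. Qed.

Let same_side x y : x \in X -> y \in X -> (x \in S) = (y \in S) -> x = y.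
Proof.
by move=> /XP[]-> /XP[]-> //; rewrite sS (negbTE tS).
Qed.

Let card_same_side v :
  #|[set u in X | adj G v u && ((v \in S) == (u \in S))]| <= 1.
Proof.
apply/card_le1_eqP => x y; rewrite inE => /and3P[xX _ /eqP xS].
rewrite inE => /and3P[yX _ /eqP yS].
by apply: same_side => //; rewrite -?xS.
Qed.

(* Flipping a degree-2 vertex that would become unfriendly keeps the cut      *)
(* minimum and raises the crossing degree of one unfriendly terminal, against *)
(* the maximality of the potential.                                           *)
Lemma no_bad_deg2 v : v != s -> v != t -> deg G v = 2 ->
  crossing_deg G (symdiff S X) v <= 1.
Proof.
move=> vs vt d2; rewrite leqNgt; apply/negP => c'2.
have vX : v \notin X by apply/negP => /XP[] e; rewrite e eqxx in vs vt.
have c1 : 2 * crossing_deg G S v <= 2.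
  by rewrite -{2}d2; apply: crossing_deg_min_st_cut minS vs vt.
have le := crossing_deg_symdiff_out S vX.
have := card_same_side v => le1.
(* At least two edges at [v] cross after the flip and at most one before, so [v] has a flipped
   neighbour on its own side of [S]. *)
have /card_gt0P[u] : 0 < #|[set u in X | adj G v u && ((v \in S) == (u \in S))]|.
  by lia.
rewrite inE => /and3P[uX vu /eqP uS].
(* Since both edges at [v] cross after the flip, every neighbour of [v] in [X] was on the side of
   [v] in [S]. *)
have all_cross w : adj G v w -> (v \in symdiff S X) (+) (w \in symdiff S X).
  move=> vw; have := deg_split G (symdiff S X) v.
  have := crossing_deg_le G (symdiff S X) v; rewrite d2 => le2 eq2.
  have /eqP : #|[set u | adj G v u &&
      ~~ ((v \in symdiff S X) (+) (u \in symdiff S X))]| = 0 by lia.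
  rewrite cards_eq0 => /eqP/setP/(_ w).
  by rewrite in_set in_set0 vw /= => /negbFE.
pose S' := symdiff S [set v].
have minS' : min_st_cut G s t S'.
  split; first by rewrite !inE sS eq_sym (negbTE vs).
    by rewrite !inE (negbTE tS) eq_sym (negbTE vt).
  case: minS => _ _ minS1 A sA tA; apply: leq_trans (minS1 A sA tA).
  (* The crossing degree of [v] in [S] is exactly 1, half its degree, so moving [v] keeps the cut
     value. *)
  by have := cut_symdiff1 G S v; rewrite d2 -/S'; lia.
have inc x : x \in X ->
    crossing_deg G S' x = crossing_deg G S x + adj G x v.
  move=> xX; apply: crossing_deg_symdiff1_other.
    by apply: contraNneq vX => ->.
  rewrite adjC => vx; have := all_cross x vx.
  rewrite !in_symdiff xX (negbTE vX).
  by case: (v \in S); case: (x \in S).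
(* Terminals in [X] lose no crossing edge and [u] gains one; a terminal that becomes unfriendly only
   adds to the sum. *)
suff : potential s t S < potential s t S' by rewrite ltnNge maxS.
have sub : {subset X <= unfriendly_terminals s t S'}.
  move=> x xX; have := inc x xX; move: xX; rewrite !inE /unfriendly.
  by case/andP=> -> lt ->; lia.
rewrite /potential [ltnRHS](bigID (mem X)) /=.
apply: leq_trans (leq_addr _ _).
rewrite [ltnRHS](eq_bigl (mem X)); last first.
  by move=> x /=; case xX: (x \in X); rewrite ?andbF // sub.
rewrite -/X (bigD1 u) //= [ltnRHS](bigD1 u) //= inc // adjC vu.
rewrite -addSn addn1 leq_add2l; apply: leq_sum => x /andP[xX _].
by rewrite inc // leq_addr.
Qed.

Lemma friendly_symdiff : friendly G (1 / 6%:R)%R (symdiff S X).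
Proof.
apply: friendly_sixth => v; have := @no_deg1 v.
have := crossing_deg_le G (symdiff S X) v.
have := crossing_deg_le G S v.
case vX: (v \in X).
  (* Here the degree d is at least 2, and the new crossing degree c satisfies 6c <= d + 5 <= 5d. *)
  have := crossing_deg_symdiff_in S vX.
  have : #|X :\ v| <= 1.
    apply/card_le1_eqP => x y; rewrite !in_setD1.
    move=> /andP[xv xX] /andP[yv yX].
    case: (XP vX) (XP xX) (XP yX) xv yv => -> [] -> [] -> //;
      by rewrite eqxx.
  by move: vX; rewrite !inE /unfriendly => /andP[_]; lia.
have := crossing_deg_symdiff_out S (negbT vX).
have [vst|] := boolP ((v == s) || (v == t)).
  (* A neighbour of this terminal in [X] can only be the other terminal, which lies across [S], so
     no crossing edge is gained. *)
  have -> : #|[set u in X | adj G v u && ((v \in S) == (u \in S))]| = 0.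
    apply/eqP; rewrite cards_eq0; apply/eqP/setP => u; rewrite in_set in_set0.
    apply/negP=> /and3P[uX vu /eqP uS]; case/negP: (adj_neq vu).
    by case/orP: vst uS => /eqP->; case: (XP uX) => ->;
      rewrite ?sS ?(negbTE tS).
  by move: vX; rewrite !inE vst /unfriendly /=; lia.
rewrite negb_or => /andP[vs vt].
have := crossing_deg_min_st_cut minS vs vt.
have := no_bad_deg2 vs vt; have := card_same_side v.
(* At most half the edges crossed and at most one is gained, which suffices from degree 3 on; degree
   2 needs [no_bad_deg2]. *)
case: (eqVneq (deg G v) 2) => [->|]; last by lia.
by move=> _ /(_ erefl); lia.
Qed.

Lemma cut_symdiff_unfriendly : cut G (symdiff S X) <= 2 * #|V|.
Proof.
apply: leq_trans (cut_symdiff_le G S X) _.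
(* Comparison with [[set s]] leaves a budget of [#|V|] for the flips. *)
have cS : cut G S <= deg G s.
  case: minS => _ _ /(_ [set s]); rewrite cut_set1 inE eqxx; apply=> //.
  by rewrite inE; apply: contraNneq tS => ->.
have dn v : deg G v <= #|V| by apply/ltnW/deg_ltn.
suff : \sum_(x in X) (deg G x - crossing_deg G S x) <= #|V|.
  by have := dn s; lia.
(* An unfriendly terminal adds less than a sixth of its degree; half of [#|V|] is a crude bound that
   suffices for two terminals. *)
have le x : x \in X -> deg G x - crossing_deg G S x <= #|V|./2.
  by rewrite !inE /unfriendly => /andP[_]; have := dn x; lia.
apply: (@leq_trans (\sum_(x in X) #|V|./2)); first exact: leq_sum.
rewrite sum_nat_const.
have : #|X| <= 2.
  apply: leq_trans (_ : #|[set s; t]| <= 2); last by rewrite cards2; case: eqP.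
  by apply/subset_leq_card/subsetP => x; rewrite inE => /andP[].
by nia.
Qed.

End MaxPotential.

End FriendlyModification.

(** * Recovering minimum cuts from the sparsifier and the degrees *)

Section Recovery.

Variable V : finType.
Implicit Types (B S X e : {set V}) (H : contraction V).
Implicit Types (d : {ffun V -> nat}) (s t : V).

(** When [H] contracts a graph with degrees [d], this counts the edges at [v] inside its
    super-vertex. *)
Definition hidden_deg H d v : nat :=
  d v - #|[set e in contracted_edges H | v \in e]|.

(* A pair [(S, X)] stands for the cut [S], obtained from the cut              *)
(* [symdiff S X] preserved by [H] by flipping the terminals in [X].           *)
Definition candidate H s t (p : {set V} * {set V}) : bool :=
  [&& s \in p.1, t \notin p.1, p.2 \subset [set s; t] &
      [forall B in supervertices H, Defs.unsplit B (symdiff p.1 p.2)]].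

Definition cut_estimate H d (p : {set V} * {set V}) : nat :=
  #|[set e in contracted_edges H | crosses p.1 e]| +
  \sum_(x in p.2) hidden_deg H d x.

Definition recover H d s t : {set V} * nat :=
  let p := [arg min_(p < ([set s], [set s]) | candidate H s t p)
              cut_estimate H d p] in
  (p.1, cut_estimate H d p).

(** Makes the search range of [recover] nonempty: flipping [s] in [[set s]] leaves the empty set,
    which splits no super-vertex. *)
Lemma candidate_set1 H s t : s != t -> candidate H s t ([set s], [set s]).
Proof.
move=> st; rewrite /candidate /= !inE eqxx eq_sym st sub1set !inE eqxx /=.
apply/forall_inP => B _; apply/orP; right.
have -> : symdiff [set s] [set s] = set0.
  by apply/setP=> x; rewrite !inE addbb.
by rewrite -setI_eq0 setI0.
Qed.

Lemma unsplit_not_crosses (G : graph V) B S e : e \in edges G ->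
  e \subset B -> Defs.unsplit B S -> ~~ crosses S e.
Proof.
case/edge_pair=> x [y [xy ->]]; rewrite crosses_pair // subUset !sub1set.
move=> /andP[xB yB] /orP[/subsetP sBS|dBS]; first by rewrite !sBS.
by rewrite !(disjointFr dBS).
Qed.

Lemma cut_estimateE (G : graph V) H s t p : contraction_of G H ->
  candidate H s t p -> cut_estimate H [ffun v => deg G v] p = cut G p.1.
Proof.
case: p => S X [_ eF] /and4P[/= sS tS XST /forall_inP un].
pose F := contracted_edges H; pose D := edges G :\: F.
have sF : F \subset edges G.
  by apply/subsetP => e; rewrite /F eF inE => /andP[].
have split_edges (P : pred {set V}) :
    #|[set e in edges G | P e]| = #|[set e in F | P e]| + #|[set e in D | P e]|.
  rewrite -(cardsID F); congr (_ + _); apply: eq_card => e; rewrite !inE.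
    by case: (boolP (e \in F)) => [/(subsetP sF)->|]; rewrite ?andbF ?andbT.
  by rewrite andbA.
have XP x : x \in X -> x = s \/ x = t.
  by move/(subsetP XST); rewrite !inE => /orP[] /eqP; [left|right].
have crossD e : e \in D -> nat_of_bool (crosses S e) = \sum_(x in X) (x \in e).
  rewrite inE => /andP[eF' eE].
  have ncr : ~~ crosses (symdiff S X) e.
    move: eF'; rewrite /F eF inE eE negbK => /exists_inP[B BH sB].
    exact: unsplit_not_crosses eE sB (un B BH).
  move: (ncr); rewrite (crosses_symdiff S X eE) negb_add => /eqP->.
  have -> : \sum_(x in X) (x \in e) = #|e :&: X|.
    rewrite -sum1_card big_mkcond [RHS]big_mkcond /=.
    by apply: eq_bigr => x _; rewrite inE andbC; case: (x \in X).
  suff : #|e :&: X| <= 1 by rewrite /crosses; case: #|_| => [|[]].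
  apply/card_le1_eqP => x y; rewrite !inE => /andP[xe xX] /andP[ye yX].
  (* An edge with both ends in [X] would join [s] to [t], which stay separated when both are
     flipped. *)
  apply/eqP/negPn/negP; rewrite eq_sym => xy; move: ncr.
  have -> : e = [set x; y].
    apply/esym/eqP; rewrite eqEcard (edge_card eE) cards2 xy andbT.
    by rewrite subUset !sub1set xe.
  rewrite crosses_pair // !in_symdiff xX yX.
  by case: (XP x xX) (XP y yX) xy => -> [] ->;
    rewrite ?eqxx // ?sS ?(negbTE tS).
rewrite /cut_estimate /cut /= split_edges; congr (_ + _).
have -> : #|[set e in D | crosses S e]| = \sum_(e in D) crosses S e.
  by rewrite -sum1_card big_mkcond [RHS]big_mkcond /=;
    apply: eq_bigr => e _; rewrite inE; case: (e \in D).
(* Double counting of pairs formed by a contracted edge and a flipped endpoint of it. *)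
rewrite (eq_bigr _ crossD) exchange_big /=; apply: eq_bigr => x _.
rewrite /hidden_deg ffunE /deg split_edges -/F addKn.
rewrite -sum1_card big_mkcond [RHS]big_mkcond /=.
by apply: eq_bigr => e _; rewrite inE; case: (e \in D).
Qed.

(** The sparsifier preserves the friendly cut [symdiff S X]; storing [X] beside [S] records how to
    undo the flip. *)
Lemma exists_optimal_candidate (G : graph V) H s t :
  (forall v, deg G v <> 1) ->
  friendly_cut_sparsifier G (1 / 6%:R)%R (2 * #|V|) H -> s != t ->
  exists2 p, candidate H s t p & min_st_cut G s t p.1.
Proof.
move=> no1 [HG spars] st.
have [S minS maxS] := exists_min_st_cut_max_potential G st.
pose X := unfriendly_terminals G s t S.
exists (S, X) => //; case: (minS) => sS tS _.
rewrite /candidate /= sS tS /=; apply/andP; split.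
  by apply/subsetP => x; rewrite inE => /andP[].
apply/forall_inP; apply/(contraction_cutE (symdiff S X) HG).
by apply: spars; [exact: friendly_symdiff | exact: cut_symdiff_unfriendly].
Qed.

End Recovery.

Theorem theorem2p1 :
  exists recover : forall V : finType,
      contraction V -> {ffun V -> nat} -> V -> V -> {set V} * nat,
  forall (V : finType) (G : graph V) (H : contraction V),
    (forall v : V, deg G v <> 1) ->
    friendly_cut_sparsifier G (1 / 6%:R)%R (2 * #|V|) H ->
    forall s t : V, s <> t ->
      let r := recover V H [ffun v => deg G v] s t in
      min_st_cut G s t r.1 /\ r.2 = cut G r.1.
Proof.
exists recover => V G H no1 spars s t /eqP st; have [HG _] := spars.
rewrite /recover; case: arg_minnP => [|p cp minp /=].
  exact: candidate_set1.
split; last exact: cut_estimateE HG cp.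
(* Estimates of candidates are exact, so the least one is at most the value of the minimum cut in
   [q]. *)
have [q cq [_ _ minq]] := exists_optimal_candidate no1 spars st.
case/and4P: (cp) => sp tp _ _; split=> // S' sS' tS'.
apply: leq_trans (minq S' sS' tS').
by rewrite -(cut_estimateE HG cp) -(cut_estimateE HG cq) minp.
Qed.
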